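(* Let $T>0$ be a finite constant. For every $k\in\mathbb{R}\setminus\{0\}$, the function $$u_k(t,x)=k\ln\Big(\frac{T-t+x}{T-t-x}\Big),\qquad |x|<T-t,\quad t\in[0,T),$$ is a self-similar solution both of the one dimensional Born-Infeld equation $$u_{tt}(1+u_x^2)-u_{xx}(1-u_t^2)=2u_tu_xu_{tx}$$ and of the one dimensional linear wave equation $$u_{tt}-u_{xx}=0$$ in the region $\{(t,x): |x|<T-t,\ t\in[0,T)\}$, with $T$ its maximal existence time. Moreover, as solutions of the Born-Infeld equation, the functions $u_k$ are timelike, i.e. $1-(\partial_t u_k)^2+(\partial_x u_k)^2>0$ in this region.
   Context: Self-similar means that the solution depends on $(t,x)$ only through the similarity variable $\rho=\frac{x}{T-t}$, i.e. $u(t,x)=v\big(\frac{x}{T-t}\big)$ for a function $v$ of one variable. $T$ is the maximal existence time (blow-up time) in the sense that $u_k$ is smooth for $t<T$ inside the cone $|x|<T-t$ and $|\partial_x u_k(t,0)|\to+\infty$ as $t\to T^-$. A (singular) solution $u$ of the Born-Infeld equation is called timelike if $1-(\partial_t u)^2+(\partial_x u)^2>0$. *)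

(* Defs.v *)
From Stdlib Require Import Reals.
From Coquelicot Require Import Coquelicot.
Open Scope R_scope.

(** Functions of [(t, x)] are total functions [R -> R -> R], time first. *)

Definition dt (u : R -> R -> R) : R -> R -> R :=
  fun t x => Derive (fun s => u s x) t.

Definition dx (u : R -> R -> R) : R -> R -> R :=
  fun t x => Derive (fun y => u t y) x.

Definition cone_region (T t x : R) : Prop := 0 <= t < T /\ Rabs x < T - t.

(** [Derive] is a total operator, and [ex_diff_n u n t x] constrains the
    derivatives of order [n] at the single point [(t, x)] only; it is therefore
    required on a whole neighbourhood.  On the edge [t = 0] of [cone_region]
    this neighbourhood, and the derivatives in [t], are two-sided. *)
Definition C_near (n : nat) (u : R -> R -> R) (t x : R) : Prop :=
  locally_2d (fun s y => ex_diff_n u n s y) t x.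

Definition smooth_near (u : R -> R -> R) (t x : R) : Prop :=
  forall n : nat, C_near n u t x.

Definition born_infeld_eq (u : R -> R -> R) (t x : R) : Prop :=
  dt (dt u) t x * (1 + (dx u t x) ^ 2) - dx (dx u) t x * (1 - (dt u t x) ^ 2)
  = 2 * dt u t x * dx u t x * dx (dt u) t x.

Definition wave_eq (u : R -> R -> R) (t x : R) : Prop :=
  dt (dt u) t x - dx (dx u) t x = 0.

Definition solution_in (D : R -> R -> Prop)
    (eqn : (R -> R -> R) -> R -> R -> Prop) (u : R -> R -> R) : Prop :=
  forall t x, D t x -> C_near 2 u t x /\ eqn u t x.

Definition self_similar (T : R) (u : R -> R -> R) : Prop :=
  exists v : R -> R, forall t x, cone_region T t x -> u t x = v (x / (T - t)).

Definition maximal_existence_time (T : R) (u : R -> R -> R) : Prop :=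
  (forall t x, t < T -> Rabs x < T - t -> smooth_near u t x) /\
  filterlim (fun t => Rabs (dx u t 0)) (at_left T) (Rbar_locally p_infty).

Definition timelike_in (D : R -> R -> Prop) (u : R -> R -> R) : Prop :=
  forall t x, D t x -> 1 - (dt u t x) ^ 2 + (dx u t x) ^ 2 > 0.

Definition uk (T k t x : R) : R := k * ln ((T - t + x) / (T - t - x)).

(* Main.v *)
(** In the null coordinates [a = T - t + x] and [b = T - t - x] the function [u_k]
    is [k (ln a - ln b)], so it solves the wave equation by d'Alembert.  Moreover
    [u_x ^ 2 - u_t ^ 2 = 4 k ^ 2 / (a b)], which gives the sign condition, and
    [u_tt = u_xx = u_t u_x / k], which reduces the Born-Infeld equation to the
    identity [k u_tx = (u_t ^ 2 + u_x ^ 2) / 2].  Every partial derivative of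
    [u_k] is a combination [c / a ^ m + d / b ^ m], whence smoothness. *)
Require Import Defs.
From Stdlib Require Import Reals Lra.
From Coquelicot Require Import Coquelicot.
Open Scope R_scope.

(** Induction on [n]: order [S n] asks for order [n] of the two functions given by [Derive]. These
    agree with members of [F] only on [D], and openness of [D] makes that agreement local, which
    suffices for [ex_diff_n]. *)
Lemma ex_diff_n_closed_family (D : R -> R -> Prop) (F : (R -> R -> R) -> Prop) :
  (forall t x, D t x -> locally_2d D t x) ->
  (forall f, F f -> forall t x, D t x -> continuity_2d_pt f t x) ->
  (forall f, F f -> exists g, F g /\
     forall t x, D t x -> is_derive (fun s => f s x) t (g t x)) ->
  (forall f, F f -> exists g, F g /\
     forall t x, D t x -> is_derive (fun y => f t y) x (g t x)) ->
  forall n f, F f -> forall t x, D t x -> ex_diff_n f n t x.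
Proof.
  intros Dopen Fcont Ft Fx n.
  induction n as [|n IH]; intros f Ff t x Dtx.
  - split; auto.
  - destruct (Ft f Ff) as [ft [Fft Hft]], (Fx f Ff) as [fx [Ffx Hfx]].
    split; [auto | split; [eexists; now apply Hft | split; [eexists; now apply Hfx |]]].
    split; [apply ex_diff_n_ext_loc with (f := ft) | apply ex_diff_n_ext_loc with (f := fx)];
      auto; apply locally_2d_impl with (2 := Dopen _ _ Dtx);
      apply locally_2d_forall; intros s y Dsy; symmetry; apply is_derive_unique; auto.
Qed.

(** Dropping the bound [0 <= t] of [cone_region] gives an open set, so points with [t = 0] also have
    a full neighbourhood. *)
Definition cone (T t x : R) : Prop := Rabs x < T - t.

Lemma cone_pos (T t x : R) : cone T t x -> 0 < T - t + x /\ 0 < T - t - x.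
Proof. intros H; apply Rabs_def2 in H; lra. Qed.

Lemma cone_open (T t x : R) : cone T t x -> locally_2d (cone T) t x.
Proof.
  intros H; unfold cone in *.
  (* The time and space variations each use up less than half of the gap. *)
  assert (Hd : 0 < (T - t - Rabs x) / 2) by lra.
  exists (mkposreal _ Hd); simpl; intros s y Hs Hy.
  apply Rabs_def2 in Hs.
  pose proof (Rabs_triang (y - x) x).
  replace (y - x + x) with y in * by ring; lra.
Qed.

(** Both partial derivatives preserve this shape and raise [m] by one; it contains every derivative
    of [uk] of positive order. *)
Definition null_powers (T c d : R) (m : nat) (t x : R) : R :=
  c * (/ (T - t + x)) ^ m + d * (/ (T - t - x)) ^ m.

Lemma is_derive_inv_pow (m : nat) (z : R) :
  z <> 0 -> is_derive (fun z => (/ z) ^ m) z (- INR m * (/ z) ^ S m).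
Proof.
  intros Hz; auto_derive; auto.
  (* The computed derivative has exponent [pred m]. Since [pred 0 = 0], the case [m = 0] is separate
     and rests on the factor [INR 0 = 0]. *)
  destruct m as [|m]; simpl pred; simpl pow; [simpl | ]; field; auto.
Qed.

Lemma is_derive_null_powers_t (T c d : R) (m : nat) (t x : R) :
  cone T t x ->
  is_derive (fun s => null_powers T c d m s x) t
    (null_powers T (INR m * c) (INR m * d) (S m) t x).
Proof.
  intros H; destruct (cone_pos _ _ _ H) as [Ha Hb]; unfold null_powers.
  evar_last.
  - apply @is_derive_plus; apply is_derive_scal;
      (apply (is_derive_comp (fun z => (/ z) ^ m));
        [apply is_derive_inv_pow; lra | auto_derive; [auto | reflexivity]]).
  - unfold plus, scal; simpl; unfold mult; simpl; ring.
Qed.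

(** In [t] both null coordinates have slope [-1], which cancels the sign of [- INR m]; in [x] the
    slopes are [1] and [-1], so the first coefficient keeps the minus sign. *)
Lemma is_derive_null_powers_x (T c d : R) (m : nat) (t x : R) :
  cone T t x ->
  is_derive (fun y => null_powers T c d m t y) x
    (null_powers T (- INR m * c) (INR m * d) (S m) t x).
Proof.
  intros H; destruct (cone_pos _ _ _ H) as [Ha Hb]; unfold null_powers.
  evar_last.
  - apply @is_derive_plus; apply is_derive_scal;
      (apply (is_derive_comp (fun z => (/ z) ^ m));
        [apply is_derive_inv_pow; lra | auto_derive; [auto | reflexivity]]).
  - unfold plus, scal; simpl; unfold mult; simpl; ring.
Qed.

Lemma is_derive_uk_t (T k t x : R) :
  cone T t x -> is_derive (fun s => uk T k s x) t (null_powers T (- k) k 1 t x).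
Proof.
  intros H; destruct (cone_pos _ _ _ H) as [Ha Hb]; unfold uk, null_powers.
  auto_derive.
  - repeat split; [lra | apply Rdiv_lt_0_compat; lra].
  - field; lra.
Qed.

Lemma is_derive_uk_x (T k t x : R) :
  cone T t x -> is_derive (fun y => uk T k t y) x (null_powers T k k 1 t x).
Proof.
  intros H; destruct (cone_pos _ _ _ H) as [Ha Hb]; unfold uk, null_powers.
  auto_derive.
  - repeat split; [lra | apply Rdiv_lt_0_compat; lra].
  - field; lra.
Qed.

Lemma continuity_2d_pt_null_coordinates (T t x : R) :
  continuity_2d_pt (fun t x => T - t + x) t x /\
  continuity_2d_pt (fun t x => T - t - x) t x.
Proof.
  split; [apply continuity_2d_pt_plus | apply continuity_2d_pt_minus];
    try apply continuity_2d_pt_id2;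
    (apply continuity_2d_pt_minus;
      [apply continuity_2d_pt_const | apply continuity_2d_pt_id1]).
Qed.

Lemma continuity_2d_pt_null_powers (T c d : R) (m : nat) (t x : R) :
  cone T t x -> continuity_2d_pt (null_powers T c d m) t x.
Proof.
  intros H; destruct (cone_pos _ _ _ H) as [Ha Hb].
  destruct (continuity_2d_pt_null_coordinates T t x) as [Ca Cb].
  apply continuity_2d_pt_plus; (apply continuity_2d_pt_mult;
    [apply continuity_2d_pt_const |]).
  - apply (continuity_1d_2d_pt_comp (fun z => (/ z) ^ m)); [| exact Ca].
    apply continuity_pt_filterlim, @ex_derive_continuous.
    eexists; apply is_derive_inv_pow; lra.
  - apply (continuity_1d_2d_pt_comp (fun z => (/ z) ^ m)); [| exact Cb].
    apply continuity_pt_filterlim, @ex_derive_continuous.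
    eexists; apply is_derive_inv_pow; lra.
Qed.

Lemma continuity_2d_pt_uk (T k t x : R) :
  cone T t x -> continuity_2d_pt (uk T k) t x.
Proof.
  intros H; destruct (cone_pos _ _ _ H) as [Ha Hb].
  destruct (continuity_2d_pt_null_coordinates T t x) as [Ca Cb].
  apply continuity_2d_pt_mult; [apply continuity_2d_pt_const |].
  apply (continuity_1d_2d_pt_comp ln).
  - apply continuity_pt_filterlim, continuous_ln, Rdiv_lt_0_compat; lra.
  - apply continuity_2d_pt_mult; [exact Ca |].
    apply continuity_2d_pt_inv; [exact Cb | lra].
Qed.

Lemma smooth_near_uk (T k t x : R) : cone T t x -> smooth_near (uk T k) t x.
Proof.
  intros H n.
  apply locally_2d_impl with (2 := cone_open _ _ _ H), locally_2d_forall.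
  (* The logarithm is not a null power, so [uk T k] is adjoined to the family; its first derivatives
     already lie among the null powers. *)
  apply (ex_diff_n_closed_family (cone T)
    (fun f => f = uk T k \/ exists c d m, f = null_powers T c d m)); auto.
  - apply cone_open.
  - intros f [-> | (c & d & m & ->)] s y.
    + apply continuity_2d_pt_uk.
    + apply continuity_2d_pt_null_powers.
  - intros f [-> | (c & d & m & ->)]; eexists; split; eauto.
    + intros s y; apply is_derive_uk_t.
    + intros s y; apply is_derive_null_powers_t.
  - intros f [-> | (c & d & m & ->)]; eexists; split; eauto.
    + intros s y; apply is_derive_uk_x.
    + intros s y; apply is_derive_null_powers_x.
Qed.

Lemma dt_uk (T k t x : R) :
  cone T t x -> dt (uk T k) t x = null_powers T (- k) k 1 t x.
Proof. intros H; apply is_derive_unique, is_derive_uk_t, H. Qed.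

Lemma dx_uk (T k t x : R) :
  cone T t x -> dx (uk T k) t x = null_powers T k k 1 t x.
Proof. intros H; apply is_derive_unique, is_derive_uk_x, H. Qed.

(** Used to differentiate a second time: the formulas for first derivatives hold only on the cone,
    whose openness lets them be substituted under [Derive]. *)
Lemma dt_ext_cone (T : R) (f g : R -> R -> R) :
  (forall t x, cone T t x -> f t x = g t x) ->
  forall t x, cone T t x -> dt f t x = dt g t x.
Proof.
  intros E t x H; apply Derive_ext_loc.
  apply filter_imp with (2 := locally_2d_1d_const_y _ _ _ (cone_open _ _ _ H)); auto.
Qed.

Lemma dx_ext_cone (T : R) (f g : R -> R -> R) :
  (forall t x, cone T t x -> f t x = g t x) ->
  forall t x, cone T t x -> dx f t x = dx g t x.
Proof.
  intros E t x H; apply Derive_ext_loc.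
  apply filter_imp with (2 := locally_2d_1d_const_x _ _ _ (cone_open _ _ _ H)); auto.
Qed.

Lemma dt_dt_uk (T k t x : R) :
  cone T t x -> dt (dt (uk T k)) t x = null_powers T (- k) k 2 t x.
Proof.
  intros H; rewrite (dt_ext_cone T _ _ (dt_uk T k) t x H).
  apply is_derive_unique; evar_last; [now apply is_derive_null_powers_t |].
  unfold null_powers; simpl; ring.
Qed.

Lemma dx_dx_uk (T k t x : R) :
  cone T t x -> dx (dx (uk T k)) t x = null_powers T (- k) k 2 t x.
Proof.
  intros H; rewrite (dx_ext_cone T _ _ (dx_uk T k) t x H).
  apply is_derive_unique; evar_last; [now apply is_derive_null_powers_x |].
  unfold null_powers; simpl; ring.
Qed.

Lemma dx_dt_uk (T k t x : R) :
  cone T t x -> dx (dt (uk T k)) t x = null_powers T k k 2 t x.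
Proof.
  intros H; rewrite (dx_ext_cone T _ _ (dt_uk T k) t x H).
  apply is_derive_unique; evar_last; [now apply is_derive_null_powers_x |].
  unfold null_powers; simpl; ring.
Qed.

(** On the axis [x = 0] both null coordinates equal [T - t], so [u_x = 2 k / (T - t)]. *)
Lemma dx_uk_blow_up (T k : R) :
  k <> 0 ->
  filterlim (fun t => Rabs (dx (uk T k) t 0)) (at_left T) (Rbar_locally p_infty).
Proof.
  intros hk P [M HM].
  pose proof (Rabs_pos_lt k hk) as Hk.
  pose proof (Rabs_pos M); pose proof (Rle_abs M).
  (* This radius forces [2 |k| / (T - t) > |M| + 1 > M]; the denominator is positive for every real
     [M]. *)
  assert (He : 0 < 2 * Rabs k / (Rabs M + 1)) by (apply Rdiv_lt_0_compat; lra).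
  exists (mkposreal _ He); simpl; intros t Ht HtT; apply HM.
  assert (Hb : T - t < 2 * Rabs k / (Rabs M + 1))
    by (apply Rabs_def2 in Ht; unfold minus, plus, opp in Ht; simpl in Ht; lra).
  rewrite dx_uk by (unfold cone; rewrite Rabs_R0; lra).
  replace (null_powers T k k 1 t 0) with (k * (2 / (T - t)))
    by (unfold null_powers; field; lra).
  rewrite Rabs_mult, (Rabs_pos_eq (2 / (T - t)))
    by (apply Rlt_le, Rdiv_lt_0_compat; lra).
  apply Rlt_trans with (Rabs M + 1); [lra |].
  replace (Rabs k * (2 / (T - t))) with (2 * Rabs k / (T - t)) by (field; lra).
  apply Rlt_div_r; [lra |].
  apply Rlt_div_r in Hb; lra.
Qed.

Lemma self_similar_uk (T k : R) : self_similar T (uk T k).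
Proof.
  exists (fun r => k * ln ((1 + r) / (1 - r))); intros t x [Ht Hx].
  destruct (cone_pos _ _ _ Hx) as [Ha Hb]; unfold uk.
  (* Numerator and denominator of the quotient are divided by [T - t]. *)
  do 2 f_equal; field; lra.
Qed.

Theorem theorem1p1 (T : R) (hT : 0 < T) (k : R) (hk : k <> 0) :
  self_similar T (uk T k) /\
  solution_in (cone_region T) born_infeld_eq (uk T k) /\
  solution_in (cone_region T) wave_eq (uk T k) /\
  maximal_existence_time T (uk T k) /\
  timelike_in (cone_region T) (uk T k).
Proof.
  split; [apply self_similar_uk | split; [| split; [| split; [split |]]]].
  - intros t x [_ H]; split; [now apply smooth_near_uk |].
    destruct (cone_pos _ _ _ H).
    unfold born_infeld_eq.
    rewrite dt_dt_uk, dx_dx_uk, dx_dt_uk, dt_uk, dx_uk by exact H.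
    (* The equation is now a polynomial identity in the inverses of the null coordinates. *)
    unfold null_powers; ring.
  - intros t x [_ H]; split; [now apply smooth_near_uk |].
    unfold wave_eq; rewrite dt_dt_uk, dx_dx_uk by exact H; ring.
  - intros t x _; apply smooth_near_uk.
  - now apply dx_uk_blow_up.
  - intros t x [_ H]; destruct (cone_pos _ _ _ H) as [Ha Hb].
    rewrite dt_uk, dx_uk by exact H; unfold null_powers.
    apply Rinv_0_lt_compat in Ha, Hb.
    assert (0 < k ^ 2) by (apply pow2_gt_0, hk).
    (* The goal expands to [1] plus four times this product. *)
    assert (0 < k ^ 2 * (/ (T - t + x) * / (T - t - x)))
      by (apply Rmult_lt_0_compat; [| apply Rmult_lt_0_compat]; assumption).
    lra.
Qed.
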